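(* There exist a constant $c>0$ and infinitely many finite groups $G$ together with functions $f\colon G\to\mathbb{R}$ such that the operator $M_f$ has an eigenspace all of whose elements $x$ satisfy \[ \|x\|_{L^\infty(G)}\ge c\,\frac{\sqrt{\log|G|}}{\log\log|G|}\,\|x\|_{L^2(G)}. \]
   Context: For $f\colon G\to\mathbb{C}$, $M_f$ is the $G\times G$ matrix with entry $f(gh^{-1})/|G|$ in position $(g,h)$, acting on functions $x\colon G\to\mathbb{C}$ by $(M_fx)(g)=\mathbb{E}_{h\in G}f(gh^{-1})x(h)$. Norms are normalized: $\|x\|_{L^2(G)}=(\mathbb{E}_{g\in G}|x(g)|^2)^{1/2}$, $\|x\|_{L^\infty(G)}=\max_g|x(g)|$. *)

(* Defs.v *)
From HB Require Import structures.
From mathcomp Require Import all_boot all_order all_algebra all_fingroup.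
From mathcomp Require Import complex.
From mathcomp Require Import reals exp.

Set Implicit Arguments.
Unset Strict Implicit.
Unset Printing Implicit Defensive.

Import GRing.Theory Num.Theory.
Local Open Scope ring_scope.
Local Open Scope complex_scope.

(* The regular module [^o] makes the function space a vectType over the field
   R[i], so that eigenspaces are complex vector spaces. *)
Notation cfunc R gT := {ffun gT -> (R[i]^o)%type}.

Section Defs.
Variables (R : realType) (gT : finGroupType).

Definition expect (V : fieldType) (F : gT -> V) : V :=
  (\sum_(g : gT) F g) / #|gT|%:R.

Definition conv_fun (f : gT -> R) (x : cfunc R gT) : cfunc R gT :=
  [ffun g : gT => expect (fun h => (f (g * h^-1)%g)%:C * x h)].

Lemma conv_fun_linear (f : gT -> R) : linear (conv_fun f).
Proof.
move=> a x y; apply/ffunP=> g; rewrite !ffunE /expect.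
rewrite scalerAl -mulrDl; congr (_ / _).
rewrite scaler_sumr -big_split /=; apply: eq_bigr => h _.
by rewrite !ffunE mulrDr scalerAr.
Qed.

HB.instance Definition _ (f : gT -> R) :=
  GRing.isLinear.Build R[i] (cfunc R gT) (cfunc R gT) _
    (conv_fun f) (conv_fun_linear f).

Definition conv_op (f : gT -> R) : 'End(cfunc R gT) := linfun (conv_fun f).

Lemma mem_eigenspace_conv (f : gT -> R) (a : R[i]) (x : cfunc R gT) :
  reflect (forall g, expect (fun h => (f (g * h^-1)%g)%:C * x h) = a * x g)
          (x \in passmx.leigenspace (conv_op f) a).
Proof.
rewrite memv_ker !lfun_simp subr_eq0 /=.
apply: (iffP eqP) => [/ffunP fx g|fx]; first by have := fx g; rewrite !ffunE.
by apply/ffunP => g; rewrite !ffunE fx.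
Qed.

Definition cmod (z : R[i]) : R := ComplexField.Normc.normc z.

Definition L2norm (x : cfunc R gT) : R :=
  Num.sqrt (expect (fun g => cmod (x g) ^+ 2)).

(* The default value 0 is harmless: the moduli are nonnegative. *)
Definition Linfnorm (x : cfunc R gT) : R :=
  \big[Num.max/0]_(g : gT) cmod (x g).

End Defs.

(* Main.v *)
(* The group is the symmetric group S_d with d = 2m.  Let v in R^d have entries
   1/sqrt k and -1/sqrt k for k = 1, ..., m, so that v has sum zero, and let
   f(g) = <v, gv>.  Since f(g h^-1) is the inner product of two vectors of the
   orbit of v, every eigenfunction of M_f with nonzero eigenvalue has the form
   x(g) = <gv, w> for some w of sum zero.  Double transitivity of S_d gives the
   eigenvalue a = |v|^2 / (d - 1), and ||x||_2^2 = a |w|^2.  On the other hand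
   every sum-zero w satisfies max_g |<gv, w>| >= |w|: sort w and pair its large
   entries with its small ones.  Hence ||x||_oo / ||x||_2 >= 1 / sqrt a up to a
   constant (complex x being split into real and imaginary parts), which is of
   order sqrt (d / log d), whereas log |G| is of order d log d. *)
Require Import Defs.
From mathcomp Require Import all_boot all_order all_algebra all_fingroup.
From mathcomp Require Import complex ring lra zify.
From mathcomp Require Import reals exp.

Set Implicit Arguments.
Unset Strict Implicit.
Unset Printing Implicit Defensive.

Import Order.TTheory GRing.Theory Num.Theory.
Local Open Scope ring_scope.
Local Open Scope complex_scope.

(** * Spectral theory of the Gram kernel of a permutation orbit *)

Section PermutationOrbit.
Variables (F : realFieldType) (T : finType) (v : T -> F).

Definition orbit_vec (g : {perm T}) (i : T) : F := v (g^-1%g i).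

Definition orbit_kernel (g : {perm T}) : F := \sum_i v i * v (g i).

Definition orbit_moment (i j : T) : F :=
  \sum_(h : {perm T}) orbit_vec h i * orbit_vec h j.

Definition orbit_eigenvalue : F := (\sum_j v j ^+ 2) / (#|T|%:R - 1).

Lemma orbit_kernel_divE (g h : {perm T}) :
  orbit_kernel (g * h^-1)%g = \sum_j orbit_vec g j * orbit_vec h j.
Proof.
rewrite /orbit_kernel (reindex_inj (@perm_inj _ g^-1%g)) /=.
by apply: eq_bigr => j _; rewrite permM permKV.
Qed.

(** Right translation by [t] permutes the summation index [h] and absorbs [t]. *)
Lemma orbit_moment_perm (t : {perm T}) i j :
  orbit_moment (t i) (t j) = orbit_moment i j.
Proof.
rewrite /orbit_moment (reindex_inj (mulIg t)) /=.
by apply: eq_bigr => h _; rewrite /orbit_vec invMg !permM !permK.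
Qed.

Lemma perm_2transitive (i j k l : T) :
  i != j -> k != l -> exists t : {perm T}, t i = k /\ t j = l.
Proof.
(* The first transposition sends [i] to [k]; the second corrects the image of [j] and fixes [k]. *)
move=> ij kl; exists (tperm i k * tperm (tperm i k j) l)%g; split; last first.
  by rewrite permM tpermL.
have jk : tperm i k j != k.
  by rewrite -{2}(tpermL i k) (inj_eq perm_inj) eq_sym.
by rewrite permM tpermL tpermD // eq_sym.
Qed.

Hypothesis v_sum0 : \sum_i v i = 0.

Lemma sum_orbit_vec (g : {perm T}) : \sum_i orbit_vec g i = 0.
Proof.
by rewrite -[RHS]v_sum0 [RHS](reindex_inj (@perm_inj _ g^-1%g)).
Qed.

(* Double transitivity makes the second moment matrix of the orbit of [v] a
   combination of the identity and the all-ones matrix; the zero row sums and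
   the trace then determine it. *)
Lemma orbit_moment_mulr (u : T -> F) i : (1 < #|T|)%N -> \sum_j u j = 0 ->
  \sum_j orbit_moment i j * u j =
    #|{perm T}|%:R * orbit_eigenvalue * u i.
Proof.
move=> T_gt1 u0.
have [k ki] : exists k, k != i.
  have : (0 < #|[set~ i]|)%N by rewrite cardsC1; lia.
  by case/card_gt0P => k; rewrite !inE; exists k.
set A := orbit_moment i i; set B := orbit_moment i k.
have offdiag j : j != i -> orbit_moment i j = B.
  move=> ji; have [t [ti tj]] : exists t : {perm T}, t i = i /\ t j = k.
    by apply: perm_2transitive; rewrite eq_sym.
  by rewrite -(orbit_moment_perm t) ti tj.
have diag j : orbit_moment j j = A.
  by rewrite -(orbit_moment_perm (tperm j i)) tpermL.
have rowsum : A + B * (#|T|%:R - 1) = 0.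
  have : \sum_j orbit_moment i j = 0.
    rewrite exchange_big big1 //= => h _.
    by rewrite -mulr_sumr sum_orbit_vec mulr0.
  rewrite (bigD1 i) //= -/A (eq_bigr (fun=> B)) //.
  rewrite sumr_const cardC1 => sum0.
  by rewrite -[RHS]sum0 -[B *+ _]mulr_natr -subn1 natrB // ltnW.
have trace : #|T|%:R * A = #|{perm T}|%:R * \sum_j v j ^+ 2.
  transitivity (\sum_j orbit_moment j j).
    by rewrite (eq_bigr _ (fun j _ => diag j)) sumr_const mulr_natl.
  rewrite exchange_big /= (eq_bigr (fun=> \sum_j v j ^+ 2)).
    by rewrite sumr_const mulr_natl.
  move=> h _; rewrite [RHS](reindex_inj (@perm_inj _ h^-1%g)) /=.
  by apply: eq_bigr => j _; rewrite expr2.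
have T1 : 0 < #|T|%:R - 1 :> F by rewrite subr_gt0 ltr1n.
(* With d = [#|T|], [rowsum] gives B = - A / (d - 1), so A - B = d A / (d - 1), and [trace]
   evaluates d A. *)
have -> : #|{perm T}|%:R * orbit_eigenvalue = A - B.
  rewrite /orbit_eigenvalue mulrA -trace; apply/eqP; rewrite eq_sym -subr_eq0; apply/eqP.
  apply: (mulfI (lt0r_neq0 T1)).
  rewrite mulrBr mulrCA divff ?lt0r_neq0 // mulr0 mulr1.
  by rewrite -[RHS](oppr0) -rowsum; ring.
rewrite (bigD1 i) //= -/A (eq_bigr (fun j => B * u j)); last first.
  by move=> j ji; rewrite offdiag.
move: u0; rewrite (bigD1 i) //= => u0.
by rewrite -mulr_sumr -[\sum_(_ | _) _](addKr (u i)) u0; ring.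
Qed.

(** The kernel is the matrix coefficient in the direction [v] itself; it serves to show that the
    eigenvalue is attained. *)
Lemma orbit_kernel_eigen (g : {perm T}) : (1 < #|T|)%N ->
  \sum_h orbit_kernel (g * h^-1)%g * orbit_kernel h =
    #|{perm T}|%:R * orbit_eigenvalue * orbit_kernel g.
Proof.
move=> T_gt1.
have kE h : orbit_kernel h = \sum_j v j * orbit_vec h j.
  rewrite -{1}[h]mulg1 -invg1 orbit_kernel_divE.
  by apply: eq_bigr => j _; rewrite mulrC /orbit_vec invg1 perm1.
under eq_bigr => h _ do rewrite orbit_kernel_divE kE big_distrlr /=.
rewrite exchange_big /= kE mulr_sumr; apply: eq_bigr => i _.
rewrite mulrA -(orbit_moment_mulr i T_gt1 v_sum0) exchange_big /= mulr_suml.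
apply: eq_bigr => j _; rewrite /orbit_moment !mulr_suml.
by apply: eq_bigr => h _; ring.
Qed.

(* An eigenfunction is automatically a matrix coefficient
   [g |-> <orbit_vec g, w>]; pairing it with itself evaluates its L2 norm, so
   only the orbit's width in the direction [w] remains to be bounded. *)
Lemma orbit_eigenfunction_L2 (y : {perm T} -> F) (B : F) :
  0 < orbit_eigenvalue ->
  (forall g, \sum_h orbit_kernel (g * h^-1)%g * y h =
     #|{perm T}|%:R * orbit_eigenvalue * y g) ->
  (forall w : T -> F, \sum_i w i = 0 ->
     exists g, \sum_i w i ^+ 2 <= (\sum_i orbit_vec g i * w i) ^+ 2) ->
  (forall g, y g ^+ 2 <= B) ->
  \sum_g y g ^+ 2 <= #|{perm T}|%:R * orbit_eigenvalue * B.
Proof.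
move=> a_gt0 eigy width yB; set K := #|_|%:R * _.
have K_gt0 : 0 < K.
  by rewrite mulr_gt0 // ltr0n; apply/card_gt0P; exists 1%g.
(* Expanding the kernel as a Gram matrix in the eigenvalue equation forces this choice of [w]. *)
pose w i := (\sum_h y h * orbit_vec h i) / K.
have w0 : \sum_i w i = 0.
  rewrite -mulr_suml exchange_big big1 ?mul0r //= => h _.
  by rewrite -mulr_sumr sum_orbit_vec mulr0.
have Kw i : K * w i = \sum_h y h * orbit_vec h i.
  by rewrite /w mulrCA divff ?mulr1 // lt0r_neq0.
have yE g : y g = \sum_i orbit_vec g i * w i.
  apply: (mulfI (lt0r_neq0 K_gt0)); rewrite -eigy.
  under eq_bigr => h _ do rewrite orbit_kernel_divE mulr_suml.
  rewrite exchange_big mulr_sumr; apply: eq_bigr => i _ /=.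
  by rewrite mulrCA Kw mulr_sumr; apply: eq_bigr => h _; ring.
have [g wg] := width w w0.
rewrite -yE in wg.
suff -> : \sum_h y h ^+ 2 = K * \sum_i w i ^+ 2.
  by rewrite ler_pM2l // (le_trans wg).
under eq_bigr => h _ do rewrite expr2 {2}yE mulr_sumr.
rewrite exchange_big mulr_sumr; apply: eq_bigr => i _ /=.
under eq_bigr => h _ do rewrite mulrA.
by rewrite -mulr_suml expr2 mulrA Kw.
Qed.

End PermutationOrbit.

(** * Sorting, and the width of the orbit of the inverse square root profile *)

Lemma sorting_perm (F : realFieldType) (d : nat) (w : 'I_d -> F) :
  exists s : {perm 'I_d},
    forall i j : 'I_d, (i <= j)%N -> w (s j) <= w (s i).
Proof.
pose leT := [rel i j | w j <= w i]; pose t := sort leT (enum 'I_d).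
have szt : size t = d by rewrite size_sort size_enum_ord.
have tsorted : sorted leT t by apply: sort_sorted => i j; exact: le_total.
have tuniq : uniq t by rewrite sort_uniq enum_uniq.
(* The default [i] is never reached, since [t] has size [d]; it avoids assuming that ['I_d] is
   inhabited. *)
have s_inj : injective (fun i : 'I_d => nth i t i).
  move=> i j; rewrite (set_nth_default j) ?szt // => /eqP.
  by rewrite nth_uniq ?szt // => /eqP/val_inj.
exists (perm s_inj) => i j ij; rewrite !permE (set_nth_default i) ?szt //.
apply: (sorted_leq_nth _ _ _ tsorted); rewrite ?inE ?szt //.
by move=> a b c /= ba cb; exact: le_trans cb ba.
by move=> a /=.
Qed.

Section Profile.
Variable R : rcfType.

Definition invsqrt (k : nat) : R := (Num.sqrt k.+1%:R)^-1.

Lemma invsqrt_gt0 k : 0 < invsqrt k.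
Proof. by rewrite invr_gt0 sqrtr_gt0 ltr0Sn. Qed.

Lemma sqr_invsqrt k : invsqrt k ^+ 2 = k.+1%:R^-1.
Proof. by rewrite exprVn sqr_sqrtr. Qed.

Lemma invsqrt_le k l : (k <= l)%N -> invsqrt l <= invsqrt k.
Proof. by move=> kl; rewrite lef_pV2 ?posrE ?sqrtr_gt0 // ler_sqrt // ler_nat. Qed.

(* The Lorentz norm l^{2,1} dominates the l^2 norm. *)
Lemma sum_sqr_le_invsqrt m (b : 'I_m -> R) :
  (forall k, 0 <= b k) -> (forall k l : 'I_m, (k <= l)%N -> b l <= b k) ->
  \sum_k b k ^+ 2 <= (\sum_(k < m) invsqrt k * b k) ^+ 2.
Proof.
elim: m b => [|m IH] b b_ge0 b_dec; first by rewrite !big_ord0 expr0n.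
rewrite !big_ord_recr /=; set wd := widen_ord _.
have := IH (b \o wd) (fun k => b_ge0 _) (fun k l kl => b_dec (wd k) (wd l) kl).
rewrite /=; set Q := \sum_(i < m) _ ^+ 2; set S := \sum_(i < m) _; move=> QS.
set z := b ord_max; set e := invsqrt m.
(* Each earlier term is at least the last one, [e * z]. Hence the cross term of (S + e z)^2 is at
   least 2 m (e z)^2, which suffices because z^2 = (m + 1) (e z)^2. *)
have Sz : m%:R * (e * z) <= S.
  rewrite mulr_natl -[m in _ *+ m]card_ord -sumr_const; apply: ler_sum => k _.
  apply: ler_pM; rewrite ?b_ge0 //; first exact: ltW (invsqrt_gt0 _).
    by apply: invsqrt_le; rewrite ltnW.
  by apply: b_dec; rewrite /= ltnW.
have e2 : m.+1%:R * e ^+ 2 = 1 by rewrite sqr_invsqrt divff // pnatr_eq0.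
have ez : 0 <= e * z by rewrite mulr_ge0 ?b_ge0 // ltW // /e invsqrt_gt0.
have m0 : 0 <= m%:R :> R by [].
have zE : z ^+ 2 = (m%:R + 1) * (e * z) ^+ 2.
  by rewrite exprMn mulrA natr1 e2 mul1r.
have h1 : m%:R * (e * z) * (e * z) <= S * (e * z) by rewrite ler_wpM2r.
have h2 : 0 <= m%:R * (e * z) * (e * z) by apply: mulr_ge0 => //; apply: mulr_ge0.
rewrite zE; lra.
Qed.

(** Reversing the negative half makes the profile nonincreasing over the whole range, in step with
    the order produced by [sorting_perm]. *)
Definition profile m (i : 'I_(m + m)) : R :=
  match split i with
  | inl k => invsqrt k
  | inr k => - invsqrt (rev_ord k)
  end.

Lemma profile_lshift m k : profile (lshift m k) = invsqrt k.
Proof. by rewrite /profile (unsplitK (inl k)). Qed.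

Lemma profile_rshift m (k : 'I_m) :
  profile (rshift m (rev_ord k)) = - invsqrt k.
Proof. by rewrite /profile (unsplitK (inr (rev_ord k))) rev_ordK. Qed.

Lemma sum_mirror m (h : 'I_(m + m) -> R) :
  \sum_i h i = \sum_k (h (lshift m k) + h (rshift m (rev_ord k))).
Proof. by rewrite big_split_ord big_split /= [X in _ + X](reindex_inj rev_ord_inj). Qed.

Lemma sum_profile m : \sum_i @profile m i = 0.
Proof.
rewrite sum_mirror big1 // => k _.
by rewrite profile_lshift profile_rshift subrr.
Qed.

Lemma sum_sqr_profile m :
  \sum_i @profile m i ^+ 2 = 2 * \sum_(k < m) k.+1%:R^-1.
Proof.
rewrite sum_mirror mulr_sumr; apply: eq_bigr => k _.
by rewrite profile_lshift profile_rshift sqrrN sqr_invsqrt mulr2n mulrDl !mul1r.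
Qed.

(* Sort [w] and pair its k-th largest with its k-th smallest entry: the l^2
   norm of the gaps dominates the distance of [w] to its median, hence to its
   mean 0. *)
Lemma profile_orbit_width m (w : 'I_(m + m) -> R) : \sum_i w i = 0 ->
  exists g, \sum_i w i ^+ 2 <= (\sum_i orbit_vec (@profile m) g i * w i) ^+ 2.
Proof.
move=> w0; have [s ws] := sorting_perm w; exists s.
rewrite (reindex_inj (@perm_inj _ s)) [X in X ^+ 2](reindex_inj (@perm_inj _ s)) /=.
rewrite (reindex_inj (@perm_inj _ s)) in w0.
under [X in X ^+ 2]eq_bigr do rewrite /orbit_vec permK.
have [m0|m_gt0] := posnP m.
  by rewrite big1 ?sqr_ge0 // => -[i im]; exfalso; move: im; rewrite m0.
have pm : (m.-1 < m)%N by rewrite prednK.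
(* The smallest entry of the upper half is a median, so [p] and [q] are nonnegative; it cancels in
   [p k + q k]. *)
pose mu := w (s (lshift m (Ordinal pm))).
pose p k := w (s (lshift m k)) - mu.
pose q k := mu - w (s (rshift m (rev_ord k))).
have p_ge0 k : 0 <= p k.
  by rewrite subr_ge0 ws //= -ltnS prednK.
have q_ge0 k : 0 <= q k.
  by rewrite subr_ge0 ws //= (leq_trans (leq_pred m)) ?leq_addr.
have p_dec (k l : 'I_m) : (k <= l)%N -> p l <= p k by move=> kl; rewrite lerD2r ws.
have q_dec (k l : 'I_m) : (k <= l)%N -> q l <= q k.
  by move=> kl; rewrite lerD2l lerN2 ws //= leq_add2l leq_sub2l.
have -> : \sum_i @profile m i * w (s i) = \sum_(k < m) invsqrt k * (p k + q k).
  rewrite sum_mirror; apply: eq_bigr => k _.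
  by rewrite profile_lshift profile_rshift /p /q; ring.
apply: le_trans (sum_sqr_le_invsqrt _ _); last 2 first.
- by move=> k; rewrite addr_ge0.
- by move=> k l kl; rewrite lerD ?p_dec ?q_dec.
(* Dropping the cross terms 2 p q leaves the squared distance to [mu], which exceeds the sum of the
   w^2 by 2 m mu^2 because [w] has sum zero. *)
apply: (@le_trans _ _ (\sum_i (w (s i) - mu) ^+ 2)); last first.
  rewrite sum_mirror; apply: ler_sum => k _.
  rewrite -/(p k) -[X in _ + X]sqrrN opprB -/(q k).
  by rewrite [leRHS]sqrrD addrAC lerDl mulrn_wge0 // mulr_ge0.
under [leRHS]eq_bigr do rewrite sqrrB.
rewrite !big_split /= sumrN sumrMnl -mulr_suml w0 mul0r mul0rn oppr0 addr0.
by rewrite lerDl sumr_ge0 // => i _; exact: sqr_ge0.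
Qed.

End Profile.

(** * Elementary bounds on logarithms, factorials and harmonic sums *)

Section Asymptotics.
Variable R : realType.

Lemma ln_subr1 (x : R) : 0 < x -> ln x <= x - 1.
Proof.
move=> x_gt0; have := @le_ln1Dx R (x - 1).
by rewrite [1 + _]addrC subrK; apply; rewrite ltrBrDl subrr.
Qed.

Lemma ln2_ge_half : 2^-1 <= ln 2 :> R.
Proof.
have := @ln_subr1 2^-1; rewrite lnV ?posrE //.
by move/(_ ltac:(by rewrite invr_gt0)); lra.
Qed.

(** The inductive step is ln x <= x - 1 at x = (m + 1) / (m + 2). *)
Lemma harmonic_le_ln m : \sum_(k < m.+1) k.+1%:R^-1 <= 1 + ln m.+1%:R :> R.
Proof.
elim: m => [|m IH]; first by rewrite big_ord1 ln1 invr1 addr0.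
rewrite big_ord_recr /=.
have := @ln_subr1 (m.+1%:R / m.+2%:R) (divr_gt0 (ltr0Sn _ _) (ltr0Sn _ _)).
rewrite ln_div ?posrE ?ltr0Sn //.
have -> : m.+1%:R / m.+2%:R - 1 = - m.+2%:R^-1 :> R.
  by rewrite -[m.+1%:R](addrK 1) natr1 mulrBl divff ?pnatr_eq0 //; ring.
move=> lnS; apply: le_trans (lerD IH (lexx _)) _; rewrite -addrA lerD2l.
by rewrite -lerBrDl -lerN2 opprB.
Qed.

Lemma fact_le_expn n : (n`! <= n ^ n)%N.
Proof.
case: n => // n; elim: n => // n IH; rewrite factS expnS leq_mul2l /=.
by rewrite (leq_trans IH) // leq_exp2r.
Qed.

Lemma expn2_le_fact n : (2 ^ n <= n.+1`!)%N.
Proof. by elim: n => // n IH; rewrite factS expnS leq_mul. Qed.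

Lemma ln_fact_le d : (0 < d)%N -> ln d`!%:R <= d%:R * ln d%:R :> R.
Proof.
move=> d_gt0; rewrite mulr_natl -lnXn ?ltr0n // -natrX.
by rewrite ler_ln ?posrE ?ltr0n ?fact_gt0 ?expn_gt0 ?d_gt0 // ler_nat fact_le_expn.
Qed.

Lemma ln_fact_ge d : (d%:R - 1) / 2 <= ln d`!%:R :> R.
Proof.
case: d => [|d]; first by rewrite fact0 ln1; lra.
apply: (@le_trans _ _ (ln (2 ^+ d))).
  rewrite lnXn // -[X in _ <= X]mulr_natr -natr1 addrK mulrC ler_wpM2r //.
  exact: ln2_ge_half.
by rewrite ler_ln ?posrE ?exprn_gt0 ?ltr0n ?fact_gt0 // -natrX ler_nat expn2_le_fact.
Qed.

Lemma ln_ln_fact_ge d : (5 < d)%N -> ln d%:R / 2 <= ln (ln d`!%:R) :> R.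
Proof.
move=> d_gt5; have d6 : 6%:R <= d%:R :> R by rewrite ler_nat.
have L_ge := ln_fact_ge d; set L := ln d`!%:R in L_ge *.
have L_gt0 : 0 < L by lra.
suff : ln d%:R <= ln (L ^+ 2) by rewrite lnXn // mulr2n; lra.
(* It suffices that d <= ((d - 1) / 2)^2, which holds from d = 6 on. *)
rewrite ler_ln ?posrE ?exprn_gt0 //; last by lra.
by nra.
Qed.

(** This is the squared final comparison, ln |G| times twice the eigenvalue: the factors are at most
    d ln d and 16 (ln d) / d, and ln d <= 2 ln ln d!. *)
Lemma fact_vs_harmonic m : (2 < m)%N -> let d := (m + m)%N in
  0 < ln (ln d`!%:R) :> R /\
  ln d`!%:R * (2 * ((2 * \sum_(k < m) k.+1%:R^-1) / (d%:R - 1)))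
    <= (8 * ln (ln d`!%:R)) ^+ 2 :> R.
Proof.
move=> m_gt2 d; have m3 : 3%:R <= m%:R :> R by rewrite ler_nat.
have d6 : (5 < d)%N by rewrite /d; lia.
have dE : d%:R = 2 * m%:R :> R by rewrite natrD; lra.
have LL := ln_ln_fact_ge d6; have L := @ln_fact_le d ltac:(lia).
have L0 : 0 <= ln d`!%:R :> R by have := ln_fact_ge d; lra.
have ld : ln d%:R = ln 2 + ln m%:R :> R by rewrite dE lnM ?posrE //; lra.
have l2 := ln2_ge_half.
have lm : 0 <= ln m%:R :> R by rewrite ln_ge0 //; lra.
have H : \sum_(k < m) k.+1%:R^-1 <= 2 * ln d%:R :> R.
  have : \sum_(k < m) k.+1%:R^-1 <= 1 + ln m%:R :> R.
    by rewrite -(prednK (ltn_trans _ m_gt2)) // harmonic_le_ln.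
  by lra.
have H0 : 0 <= \sum_(k < m) k.+1%:R^-1 :> R.
  by apply: sumr_ge0 => k _; rewrite invr_ge0.
split; first by lra.
set S := \sum_(k < m) _ in H H0 *; set l := ln d%:R in LL L ld H *.
apply: (@le_trans _ _ ((4 * l) ^+ 2)); last first.
  by rewrite ler_sqr ?nnegrE; lra.
have dinv : 2 * (2 * S / (d%:R - 1)) <= 16 * l / d%:R.
  rewrite mulrA ler_pdivrMr; last by lra.
  rewrite mulrAC ler_pdivlMr; last by lra.
  by nra.
apply: le_trans (ler_pM L0 _ L dinv) _.
  by rewrite !mulr_ge0 // invr_ge0; lra.
have -> : d%:R * l * (16 * l / d%:R) = (4 * l) ^+ 2.
  by field; lra.
by [].
Qed.

End Asymptotics.

(** * Reduction of complex eigenfunctions to real ones *)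

Section Complex.
Variables (R : realType) (gT : finGroupType).
Implicit Types (x : cfunc R gT) (f : gT -> R).

Lemma cmod_sqr (z : R[i]) : cmod z ^+ 2 = complex.Re z ^+ 2 + complex.Im z ^+ 2.
Proof. by case: z => a b; rewrite /cmod /= sqr_sqrtr // addr_ge0 ?sqr_ge0. Qed.

Lemma cmod_le_Linfnorm x g : cmod (x g) <= Linfnorm x.
Proof. exact: (le_bigmax _ (fun g => cmod (x g))). Qed.

Lemma Linfnorm_ge0 x : 0 <= Linfnorm x.
Proof. exact: (bigmax_ge_id _ _ _ (fun g => cmod (x g))). Qed.

Lemma eigenspace_conv_ReIm f (a : R) x :
  x \in passmx.leigenspace (conv_op f) a%:C ->
  (forall g, \sum_h f (g * h^-1)%g * complex.Re (x h) = #|gT|%:R * a * complex.Re (x g)) /\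
  (forall g, \sum_h f (g * h^-1)%g * complex.Im (x h) = #|gT|%:R * a * complex.Im (x g)).
Proof.
move/mem_eigenspace_conv => xE.
have N_neq0 : #|gT|%:R != 0 :> R[i].
  by rewrite pnatr_eq0 -lt0n; apply/card_gt0P; exists 1%g.
have {}xE g : \sum_h (f (g * h^-1)%g)%:C * x h = (#|gT|%:R * a)%:C * x g.
  rewrite rmorphM rmorph_nat -mulrA -xE /expect mulrCA divff ?mulr1 //.
have ReM (b : R) (z : R[i]) : complex.Re (b%:C * z) = b * complex.Re z.
  by case: z => p q /=; rewrite mul0r subr0.
have ImM (b : R) (z : R[i]) : complex.Im (b%:C * z) = b * complex.Im z.
  by case: z => p q /=; rewrite mul0r addr0.
have ReD (y z : R[i]) : complex.Re (y + z) = complex.Re y + complex.Re z.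
  by case: y z => [? ?] [].
have ImD (y z : R[i]) : complex.Im (y + z) = complex.Im y + complex.Im z.
  by case: y z => [? ?] [].
split=> g.
  rewrite -ReM -xE (big_morph _ (id1 := 0) (op1 := +%R) ReD) //.
  by apply: eq_bigr => h _; rewrite ReM.
rewrite -ImM -xE (big_morph _ (id1 := 0) (op1 := +%R) ImD) //.
by apply: eq_bigr => h _; rewrite ImM.
Qed.

Lemma L2norm_sqr x :
  L2norm x ^+ 2 = (\sum_g complex.Re (x g) ^+ 2 + \sum_g complex.Im (x g) ^+ 2) / #|gT|%:R.
Proof.
rewrite /L2norm /expect sqr_sqrtr; last first.
  by rewrite divr_ge0 // sumr_ge0 // => g _; exact: sqr_ge0.
by rewrite -big_split; congr (_ / _); apply: eq_bigr => g _; rewrite cmod_sqr.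
Qed.

End Complex.

(** * Assembly for the symmetric groups of even degree *)

Theorem theorem3p2 (R : realType) :
  exists c : R, 0 < c /\
  exists (G : nat -> finGroupType) (f : forall n : nat, G n -> R),
    (forall m n : nat, m <> n -> ~ ([set: G m] \isog [set: G n])) /\
    (forall n : nat, exists a : R[i],
       passmx.leigenvalue (conv_op (f n)) a /\
       (forall x : cfunc R (G n), x \in passmx.leigenspace (conv_op (f n)) a ->
          c * (Num.sqrt (ln #|G n|%:R) / ln (ln #|G n|%:R)) * L2norm x
            <= Linfnorm x)).
Proof.
exists 8^-1; split; first by rewrite invr_gt0.
(* The shift by 3 meets the condition 2 < m of [fact_vs_harmonic], whose factor 8 dictates the
   constant above. *)
pose M n := n.+3; pose G n : finGroupType := {perm 'I_(M n + M n)}.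
pose v n := @profile R (M n).
exists G, (fun n => orbit_kernel (v n)); split.
  have wlt m n : (m < n)%N -> #|G m| <> #|G n|.
    move=> mn; rewrite /G !card_Sn => E.
    have : ((M m + M m)`! < (M n + M n)`!)%N by apply: ltn_fact; rewrite /M; lia.
    by rewrite E ltnn.
  move=> m n mn /card_isog; rewrite !cardsT.
  by case: (ltngtP m n) => // [/wlt|/wlt nm /esym //].
move=> n; pose d := (M n + M n)%N.
have d_gt1 : (1 < #|'I_d|)%N by rewrite card_ord.
have [LL bound] := @fact_vs_harmonic R (M n) isT.
have v0 : \sum_i v n i = 0 := sum_profile _ _.
have vsq := sum_sqr_profile R (M n).
pose a := orbit_eigenvalue (v n).
have vsq_gt0 : 0 < \sum_i v n i ^+ 2.
  rewrite vsq mulr_gt0 // big_ord_recl ltr_pwDl ?invr_gt0 ?ltr0Sn //.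
  by apply: sumr_ge0 => k _; rewrite invr_ge0.
have a_gt0 : 0 < a by rewrite divr_gt0 // subr_gt0 ltr1n.
have N_gt0 : 0 < #|G n|%:R :> R by rewrite card_Sn ltr0n fact_gt0.
exists a%:C; split.
  pose x : cfunc R (G n) := [ffun g => (orbit_kernel (v n) g)%:C].
  apply/negP => /eqP E0.
  have : x \in passmx.leigenspace (conv_op (orbit_kernel (v n))) a%:C.
    apply/mem_eigenspace_conv => g; rewrite /expect.
    under eq_bigr => h _ do rewrite ffunE -rmorphM.
    rewrite -rmorph_sum orbit_kernel_eigen // -/a ffunE -(rmorph_nat (real_complex R)).
    rewrite -fmorphV -!rmorphM; congr (_%:C).
    by field; rewrite lt0r_neq0.
  (* The kernel at the identity is the squared norm of [v n], hence nonzero. *)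
  rewrite E0 memv0 => /eqP/ffunP/(_ 1%g); rewrite !ffunE => /complexI.
  rewrite /orbit_kernel; under eq_bigr do rewrite perm1 -expr2.
  by move=> E; rewrite E ltxx in vsq_gt0.
move=> x /eigenspace_conv_ReIm [xRe xIm].
have cmodB g : cmod (x g) ^+ 2 <= Linfnorm x ^+ 2.
  rewrite ler_sqr ?nnegrE ?cmod_le_Linfnorm ?Linfnorm_ge0 //.
  by rewrite /cmod; case: (x g) => p q /=; exact: sqrtr_ge0.
(* The factor 2 comes from bounding the real and imaginary parts separately. *)
have L2 : L2norm x ^+ 2 <= 2 * a * Linfnorm x ^+ 2.
  rewrite L2norm_sqr ler_pdivrMr //.
  have yRe := orbit_eigenfunction_L2 v0 a_gt0 xRe (@profile_orbit_width R (M n)).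
  have yIm := orbit_eigenfunction_L2 v0 a_gt0 xIm (@profile_orbit_width R (M n)).
  have -> : 2 * a * Linfnorm x ^+ 2 * #|G n|%:R =
    #|G n|%:R * a * Linfnorm x ^+ 2 + #|G n|%:R * a * Linfnorm x ^+ 2 by ring.
  apply: lerD; [apply: yRe|apply: yIm] => g; apply: le_trans (cmodB g);
    by rewrite cmod_sqr (lerDl, lerDr) sqr_ge0.
have aE : a = 2 * (\sum_(k < M n) k.+1%:R^-1) / ((M n + M n)%:R - 1).
  by rewrite /a /orbit_eigenvalue vsq card_ord.
rewrite card_Sn -/d in bound LL *; rewrite -aE in bound.
set L := ln _ in bound LL *.
have L_ge0 : 0 <= L by rewrite ln_ge0 // ler1n fact_gt0.
rewrite -ler_sqr ?nnegrE ?Linfnorm_ge0 //; last first.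
  by rewrite !mulr_ge0 ?invr_ge0 ?sqrtr_ge0 // ltW.
rewrite !exprMn sqr_sqrtr //.
apply: le_trans (_ : (8^-1 ^+ 2 * (L * (ln L)^-1 ^+ 2)) * (2 * a * Linfnorm x ^+ 2) <= _).
  by rewrite ler_wpM2l // !mulr_ge0 ?exprn_ge0 ?invr_ge0 // ltW.
have -> : (8^-1 ^+ 2 * (L * (ln L)^-1 ^+ 2)) * (2 * a * Linfnorm x ^+ 2)
   = (L * (2 * a) / (8 * ln L) ^+ 2) * Linfnorm x ^+ 2.
  by field; rewrite lt0r_neq0.
rewrite ler_piMl ?sqr_ge0 // ler_pdivrMr ?mul1r // exprn_gt0 // mulr_gt0 //.
Qed.
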